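(* For every integer $k\ge 1$, the following recurrence relations hold (as identities of formal power series in $q$): $$A_k(q) = \frac{1}{(2k+1)2k}\Big(\big(6A_1(q) + k(k-1)\big)A_{k-1}(q) - 2q\frac{d}{dq}A_{k-1}(q)\Big),$$ $$C_k(q) = \frac{1}{2k(2k-1)}\Big(\big(2C_1(q) + (k-1)^2\big)C_{k-1}(q) - q\frac{d}{dq}C_{k-1}(q)\Big).$$
   Context: MacMahon's generalized sum-of-divisors generating functions are, for integers $k\ge 1$ (sums over integers $m_1,\dots,m_k$), $$A_k(q) = \sum_{0<m_1 < \cdots < m_k}\frac{q^{m_1 + \cdots + m_k}}{(1 - q^{m_1})^2 \cdots (1 - q^{m_k})^2},$$ $$C_k(q) = \sum_{0<m_1 < \cdots < m_k}\frac{q^{2m_1 + \cdots +2m_k - k}}{(1 - q^{2m_1 - 1})^2 \cdots (1 - q^{2m_k - 1})^2},$$ with the convention $A_0(q)=C_0(q)=1$. *)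

(* Defs.v *)
From HB Require Import structures.
From mathcomp Require Import all_boot all_order all_algebra.
From mathcomp Require Import boolp classical_sets cardinality fsbigop.
Set Implicit Arguments.
Unset Strict Implicit.
Unset Printing Implicit Defensive.
Import GRing.Theory.
Local Open Scope ring_scope.

Record fps (R : Type) := Fps { fpscoef : nat -> R }.

Lemma fpsP (R : Type) (f g : fps R) : fpscoef f =1 fpscoef g <-> f = g.
Proof.
by split=> [|->//]; case: f g => f [g] /= e; congr Fps; apply/funext => n; apply: e.
Qed.

HB.instance Definition _ (R : Type) := gen_eqMixin (fps R).
HB.instance Definition _ (R : Type) := gen_choiceMixin (fps R).

Section FpsRing.
Variable R : comUnitRingType.
Implicit Types (f g h : fps R) (a b : R).

Definition fps_const a := Fps (fun n => if n is 0%N then a else 0).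
Definition fps_opp f := Fps (fun n => - fpscoef f n).
Definition fps_add f g := Fps (fun n => fpscoef f n + fpscoef g n).
Definition fps_mul f g :=
  Fps (fun n => \sum_(i < n.+1) fpscoef f i * fpscoef g (n - i)%N).

Fact fps_addA : associative fps_add.
Proof. by move=> f g h; apply/fpsP => n; apply: addrA. Qed.
Fact fps_addC : commutative fps_add.
Proof. by move=> f g; apply/fpsP => n; apply: addrC. Qed.
Fact fps_add0 : left_id (fps_const 0) fps_add.
Proof. by move=> f; apply/fpsP => -[|n]; apply: add0r. Qed.
Fact fps_addN : left_inverse (fps_const 0) fps_opp fps_add.
Proof. by move=> f; apply/fpsP => -[|n]; apply: addNr. Qed.

HB.instance Definition _ := GRing.isZmodule.Build (fps R)
  fps_addA fps_addC fps_add0 fps_addN.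

Fact fps_mulC : commutative fps_mul.
Proof.
move=> f g; apply/fpsP => n /=.
rewrite (reindex_inj rev_ord_inj) /=; apply: eq_bigr => i _.
by rewrite subSS mulrC subKn // -ltnS.
Qed.

Fact fps_mulE f g N n : (n < N)%N ->
  fpscoef (fps_mul f g) n =
  ((\poly_(i < N) fpscoef f i) * (\poly_(i < N) fpscoef g i))`_n.
Proof.
move=> nN; rewrite coefM /=; apply: eq_bigr => i _.
have iN : (i < N)%N by apply: leq_ltn_trans nN; rewrite -ltnS.
by rewrite !coef_poly iN (leq_ltn_trans (leq_subr _ _) nN).
Qed.

Fact fps_mulA : associative fps_mul.
Proof.
move=> f g h; apply/fpsP => n.
pose T f := \poly_(i < n.+1) fpscoef f i.
have mulT k u v : (k <= n)%N -> (T (fps_mul u v))`_k = (T u * T v)`_k.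
  by move=> kn; rewrite coef_poly ltnS kn (@fps_mulE _ _ n.+1).
rewrite !(@fps_mulE _ _ n.+1) // -/(T _) -/(T (fps_mul f g)) -/(T h) -/(T f).
transitivity ((T f * T g * T h)`_n); last first.
  rewrite !coefM; apply: eq_bigr => i _; congr (_ * _).
  by rewrite mulT // -ltnS.
rewrite -mulrA [LHS]coefM [RHS]coefM; apply: eq_bigr => i _; congr (_ * _).
by rewrite mulT // leq_subr.
Qed.

Fact fps_mul1 : left_id (fps_const 1) fps_mul.
Proof.
move=> f; apply/fpsP => n /=; rewrite big_ord_recl /= mul1r subn0.
by rewrite big1 ?addr0 // => i _; rewrite mul0r.
Qed.

Fact fps_mulDl : left_distributive fps_mul fps_add.
Proof.
move=> f g h; apply/fpsP => n /=; rewrite -big_split; apply: eq_bigr => i _.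
exact: mulrDl.
Qed.

Fact fps_1neq0 : fps_const 1 != 0.
Proof. by apply/eqP => /fpsP /(_ 0%N) /= /eqP; rewrite oner_eq0. Qed.

HB.instance Definition _ := GRing.Zmodule_isComNzRing.Build (fps R)
  fps_mulA fps_mulC fps_mul1 fps_mulDl fps_1neq0.

Lemma fpscoef0 n : fpscoef (0 : fps R) n = 0. Proof. by case: n. Qed.
Lemma fpscoef1 n : fpscoef (1 : fps R) n = (n == 0%N)%:R.
Proof. by case: n. Qed.
Lemma fpscoefD f g n : fpscoef (f + g) n = fpscoef f n + fpscoef g n.
Proof. by []. Qed.
Lemma fpscoefN f n : fpscoef (- f) n = - fpscoef f n. Proof. by []. Qed.
Lemma fpscoefB f g n : fpscoef (f - g) n = fpscoef f n - fpscoef g n.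
Proof. by []. Qed.
Lemma fpscoefM f g n :
  fpscoef (f * g) n = \sum_(i < n.+1) fpscoef f i * fpscoef g (n - i)%N.
Proof. by []. Qed.
Lemma fpscoef_sum I (r : seq I) (P : pred I) (F : I -> fps R) n :
  fpscoef (\sum_(i <- r | P i) F i) n = \sum_(i <- r | P i) fpscoef (F i) n.
Proof.
exact: (big_morph (fun f => fpscoef f n) (fun f g => fpscoefD f g n) (fpscoef0 n)).
Qed.

Definition fps_scale a f := Fps (fun n => a * fpscoef f n).

Fact fps_scaleA a b f : fps_scale a (fps_scale b f) = fps_scale (a * b) f.
Proof. by apply/fpsP => n; apply: mulrA. Qed.
Fact fps_scale1 : left_id 1 fps_scale.
Proof. by move=> f; apply/fpsP => n; apply: mul1r. Qed.
Fact fps_scaleDr : right_distributive fps_scale +%R.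
Proof. by move=> a f g; apply/fpsP => n; apply: mulrDr. Qed.
Fact fps_scaleDl f : {morph fps_scale^~ f : a b / a + b}.
Proof. by move=> a b; apply/fpsP => n; apply: mulrDl. Qed.

HB.instance Definition _ := GRing.Zmodule_isLmodule.Build R (fps R)
  fps_scaleA fps_scale1 fps_scaleDr fps_scaleDl.

Fact fps_scaleAl a f g : a *: (f * g) = a *: f * g.
Proof.
apply/fpsP => n; rewrite [LHS]/= mulr_sumr; apply: eq_bigr => i _.
exact: mulrA.
Qed.
HB.instance Definition _ := GRing.Lmodule_isLalgebra.Build R (fps R) fps_scaleAl.
HB.instance Definition _ := GRing.Lalgebra_isComAlgebra.Build R (fps R).

Lemma fpscoefZ a f n : fpscoef (a *: f) n = a * fpscoef f n. Proof. by []. Qed.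

(* A series is invertible iff its constant term a is; the inverse is then the
   geometric series a^-1 * \sum_j (1 - a^-1 f)^j, whose terms with j > n do not
   contribute to the coefficient of degree n. *)
Definition fps_unit : pred (fps R) := fun f => fpscoef f 0 \is a GRing.unit.
Definition fps_inv f :=
  let a := fpscoef f 0 in
  if fps_unit f then
    Fps (fun n => a^-1 * \sum_(j < n.+1) fpscoef ((1 - a^-1 *: f) ^+ j) n)
  else f.

Lemma fps_low_expr g j n : fpscoef g 0 = 0 -> (n < j)%N -> fpscoef (g ^+ j) n = 0.
Proof.
move=> g0; elim: j n => // j IH n nj.
rewrite exprS fpscoefM big1 // => -[[|i] iP] _ /=; first by rewrite g0 mul0r.
by rewrite IH ?mulr0 //; case: n nj iP => // n nj _; rewrite subSS
  (leq_ltn_trans (leq_subr _ _)).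
Qed.

Fact fps_mulVr : {in fps_unit, left_inverse 1 fps_inv *%R}.
Proof.
move=> f uf; have ua : fpscoef f 0 \is a GRing.unit := uf.
rewrite /fps_inv; have -> : fps_unit f = true := uf.
set a := fpscoef f 0; set g := 1 - a^-1 *: f.
have g0 : fpscoef g 0 = 0 by rewrite fpscoefB fpscoefZ fpscoef1 mulVr ?subrr.
have fE : f = a *: (1 - g) by rewrite /g opprB addrC subrK scalerA divrr // scale1r.
apply/fpsP => n; set s := Fps _.
transitivity (fpscoef ((a^-1 *: \sum_(j < n.+1) g ^+ j) * f) n).
  rewrite !fpscoefM; apply: eq_bigr => i _; congr (_ * _).
  rewrite fpscoefZ fpscoef_sum /=; congr (_ * _).
  have le_in : (i.+1 <= n.+1)%N by [].
  rewrite (big_ord_widen _ (fun j => fpscoef (g ^+ j) i) le_in).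
  rewrite big_mkcond /=; apply: eq_bigr => j _.
  by case: ltnP => // ij; rewrite fps_low_expr.
rewrite fE -scalerAl -scalerAr scalerA mulVr // scale1r mulrC.
rewrite -(opprB g 1) mulNr -subrX1 opprB.
by rewrite fpscoefB fps_low_expr ?subr0.
Qed.

Fact fps_unitPl f g : g * f = 1 -> fps_unit f.
Proof.
move/fpsP/(_ 0%N); rewrite fpscoefM big_ord1 subn0 /= => gf.
by apply/unitrPr; exists (fpscoef g 0); rewrite mulrC.
Qed.

Fact fps_inv_out : {in [predC fps_unit], fps_inv =1 id}.
Proof. by move=> f; rewrite inE /= /fps_inv -[f \in _]/(fps_unit f) => /negPf ->. Qed.

HB.instance Definition _ := GRing.ComNzRing_hasMulInverse.Build (fps R)
  fps_mulVr fps_unitPl fps_inv_out.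

Lemma fps_unitE f : (f \is a GRing.unit) = (fpscoef f 0 \is a GRing.unit).
Proof. by []. Qed.

Definition fpsX : fps R := Fps (fun n => (n == 1%N)%:R).

Lemma fpscoefXn k n : fpscoef (fpsX ^+ k) n = (n == k)%:R.
Proof.
elim: k n => [|k IH] n; first by rewrite fpscoef1.
rewrite exprS fpscoefM; case: n => [|n].
  by rewrite big_ord1 mul0r.
rewrite big_ord_recl mul0r add0r big_ord_recl /= mul1r IH subSS subn0 eqSS.
by rewrite big1 ?addr0 // => i _; rewrite mul0r.
Qed.

Definition fps_deriv f := Fps (fun n => fpscoef f n.+1 *+ n.+1).

(* Sum of a family of series: in each degree n, the sum over the finitely many
   members of the family with nonzero coefficient of degree n.  The sum carries
   a meaning only for families satisfying fps_summable. *)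
Definition fps_summable (I : choiceType) (D : set I) (F : I -> fps R) :=
  forall n, finite_set [set i | D i /\ fpscoef (F i) n <> 0].
Definition fps_sum (I : choiceType) (D : set I) (F : I -> fps R) : fps R :=
  Fps (fun n => \sum_(i \in D) fpscoef (F i) n).

End FpsRing.

Arguments fpsX {R}.
Arguments fpscoef : simpl never.

Lemma fpscoef_deriv (R : comUnitRingType) (f : fps R) n :
  fpscoef (fps_deriv f) n = fpscoef f n.+1 *+ n.+1.
Proof. by []. Qed.

Lemma fpscoef_fps_sum (R : comUnitRingType) (I : choiceType) (D : set I)
    (F : I -> fps R) n :
  fpscoef (fps_sum D F) n = \sum_(i \in D) fpscoef (F i) n.
Proof. by []. Qed.

(* m = (m_1, ..., m_k) with 0 < m_1 < ... < m_k *)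
Definition increasing_tuples (k : nat) : set (k.-tuple nat) :=
  [set m | path ltn 0%N m]%classic.

Definition macmahonA_term (k : nat) (m : k.-tuple nat) : fps rat :=
  fpsX ^+ (\sum_(i <- m) i) / \prod_(i <- m) (1 - fpsX ^+ i) ^+ 2.

(* The truncated subtractions are exact, since every i in m is positive. *)
Definition macmahonC_term (k : nat) (m : k.-tuple nat) : fps rat :=
  fpsX ^+ (2 * (\sum_(i <- m) i) - k)
    / \prod_(i <- m) (1 - fpsX ^+ (2 * i - 1)) ^+ 2.

Definition macmahonA (k : nat) : fps rat :=
  fps_sum (@increasing_tuples k) (@macmahonA_term k).
Definition macmahonC (k : nat) : fps rat :=
  fps_sum (@increasing_tuples k) (@macmahonC_term k).

Lemma fpscoef_XnM (R : comUnitRingType) (f : fps R) k n :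
  (n < k)%N -> fpscoef (fpsX ^+ k * f) n = 0.
Proof.
move=> nk; rewrite fpscoefM big1 // => i _; rewrite fpscoefXn.
by rewrite ltn_eqF ?mul0r // (leq_ltn_trans _ nk) // -ltnS.
Qed.

Lemma macmahon_den_unit (s : seq nat) (e : nat -> nat) :
  all (fun i => 0 < e i)%N s ->
  \prod_(i <- s) (1 - fpsX ^+ e i) ^+ 2 \is a @GRing.unit (fps rat).
Proof.
elim: s => [|i s IH] /=; first by rewrite big_nil unitr1.
case/andP=> ei /IH IHs; rewrite big_cons unitrM IHs andbT unitrX //.
by rewrite fps_unitE fpscoefB fpscoefXn eq_sym (gtn_eqF ei) subr0 unitr1.
Qed.

Lemma increasing_tuples_gt0 k (m : k.-tuple nat) :
  increasing_tuples m -> all (leq 1) m.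
Proof. by move=> /(order_path_min ltn_trans). Qed.

Lemma finite_tuples_le k n :
  finite_set [set m : k.-tuple nat | all (fun i => i <= n)%N m]%classic.
Proof.
apply: (@sub_finite_set _ _
  ((fun m : k.-tuple 'I_n.+1 => map_tuple val m) @` setT)%classic).
  move=> m /= /allP mn; exists (map_tuple (@inord n) m) => //.
  apply: val_inj; rewrite /= -map_comp map_id_in // => i im /=.
  by rewrite inordK // ltnS mn.
exact: finite_image.
Qed.

Lemma macmahon_summable k (F : k.-tuple nat -> fps rat) :
  (forall m n, increasing_tuples m -> (n < \sum_(i <- m) i)%N ->
     fpscoef (F m) n = 0) ->
  fps_summable (@increasing_tuples k) F.
Proof.
move=> F0 n; apply: sub_finite_set (finite_tuples_le k n) => m /= [mP].
move=> Fn; apply/allP => i im; rewrite leqNgt; apply/negP => ni; apply: Fn.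
by apply: F0 mP _; apply: leq_trans ni _; rewrite (big_rem i im) leq_addr.
Qed.

Lemma macmahonA_summable k :
  fps_summable (@increasing_tuples k) (@macmahonA_term k).
Proof. by apply: macmahon_summable => m n _; apply: fpscoef_XnM. Qed.

Lemma macmahonC_summable k :
  fps_summable (@increasing_tuples k) (@macmahonC_term k).
Proof.
apply: macmahon_summable => m n /increasing_tuples_gt0 /allP m_gt0 nm.
apply: fpscoef_XnM; apply: leq_trans nm _.
rewrite mul2n -addnn -addnBA ?leq_addr //.
rewrite -[k in (k <= _)%N](size_tuple m) -sum1_size big_seq [leqRHS]big_seq.
by apply: leq_sum => i /m_gt0.
Qed.

Lemma increasing_tuples0 : @increasing_tuples 0 = [set [tuple]]%classic.
Proof. by apply/seteqP; split=> m // _; rewrite [m]tuple0. Qed.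

Lemma macmahonA0 : macmahonA 0 = 1.
Proof.
apply/fpsP => n; rewrite fpscoef_fps_sum increasing_tuples0 fsbig_set1.
by rewrite /macmahonA_term !big_nil expr0 divr1.
Qed.

Lemma macmahonC0 : macmahonC 0 = 1.
Proof.
apply/fpsP => n; rewrite fpscoef_fps_sum increasing_tuples0 fsbig_set1.
by rewrite /macmahonC_term !big_nil expr0 divr1.
Qed.

(* Main.v *)
Require Import Defs.
From mathcomp Require Import all_boot all_order all_algebra.
From mathcomp Require Import classical_sets fsbigop.
From mathcomp Require Import zify ring.
Import GRing.Theory.
Local Open Scope ring_scope.

(** Both recurrences say that a Jacobi theta function solves the heat equation.

    Write t = 2 - z - z^-1.  Since (1 - y)^2 + t y = (1 - z y) (1 - y / z),
    the generating series of the A_k or C_k in t,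
      \sum_k E_k t^k = \prod_e (1 + t q^e / (1 - q^e)^2),
    is up to a factor P free of z the product side of the Jacobi triple
    product.  Hence P \sum_k E_k t^k is a sum of terms +- z^s q^Q(s), where Q
    is quadratic in s.  On such a term q d/dq and a second-order operator in z
    act by the same scalar, up to a constant; in the variable t that operator
    maps t^k to a combination of t^k and t^(k-1).  Comparing coefficients of
    t^k gives a recurrence for the series P E_k.  Its case k = 0 computes the
    logarithmic derivative of P from E_1, and dividing by P gives the
    recurrence for E_k: this last part is [heat_recurrence].

    The cases A and C are treated together.  They correspond to r = 1 and
    r = 2: the exponents e are the r j + 1, and s ranges over the integers
    shifted by (2 - r) / 2.  For r = 1 the product has to be multiplied by
    z^(-1/2) - z^(1/2) to become a theta function.

    The triple product is used in a finite form, with N factors and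
    q-binomial coefficients ([theta_poly_coef]), and modulo q^(N+1), where the
    q-binomial coefficients, weighted by their powers of q, may all be replaced
    by one and the same unit ([qpoch_theta_coef]).
    Coefficients in t are extracted from powers of z by a linear functional
    whose values are central factorials ([cheb_coef]): it commutes with
    multiplication by t because the second central difference lowers the
    degree of a central factorial by two ([cfact_shift]), and the heat
    equation is the two-step recursion that defines central factorials
    ([theta_sum_heat]). *)

(** * Congruences between power series and the Euler derivation *)

Definition fps_eqmod (n : nat) (f g : fps rat) : Prop :=
  forall d, (d < n)%N -> fpscoef f d = fpscoef g d.

Lemma fps_eqmod_refl n f : fps_eqmod n f f.
Proof. by []. Qed.

Lemma fps_eqmod_sym n f g : fps_eqmod n f g -> fps_eqmod n g f.
Proof. by move=> fg d dn; rewrite fg. Qed.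

Lemma fps_eqmod_trans n f g h :
  fps_eqmod n f g -> fps_eqmod n g h -> fps_eqmod n f h.
Proof. by move=> fg gh d dn; rewrite fg ?gh. Qed.

Lemma fps_eqmod_le m n f g : (m <= n)%N -> fps_eqmod n f g -> fps_eqmod m f g.
Proof. by move=> mn fg d dm; apply: fg; apply: leq_trans dm mn. Qed.

Lemma fps_eqmodB n f1 f2 g1 g2 :
  fps_eqmod n f1 f2 -> fps_eqmod n g1 g2 -> fps_eqmod n (f1 - g1) (f2 - g2).
Proof. by move=> f12 g12 d dn; rewrite !fpscoefB f12 ?g12. Qed.

Lemma fps_eqmodM n f1 f2 g1 g2 :
  fps_eqmod n f1 f2 -> fps_eqmod n g1 g2 -> fps_eqmod n (f1 * g1) (f2 * g2).
Proof.
move=> f12 g12 d dn; rewrite !fpscoefM; apply: eq_bigr => i _.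
rewrite f12 ?g12 //; first exact: leq_ltn_trans (leq_subr _ _) dn.
exact: leq_trans (ltn_ord i) _.
Qed.

Lemma fps_eqmodZ n a f g : fps_eqmod n f g -> fps_eqmod n (a *: f) (a *: g).
Proof. by move=> fg d dn; rewrite !fpscoefZ fg. Qed.

Lemma fps_eqmod_sum n I (s : seq I) (P : pred I) (F G : I -> fps rat) :
  (forall i, P i -> fps_eqmod n (F i) (G i)) ->
  fps_eqmod n (\sum_(i <- s | P i) F i) (\sum_(i <- s | P i) G i).
Proof.
move=> FG d dn; rewrite !fpscoef_sum.
by apply: eq_bigr => i Pi; apply: FG.
Qed.

Lemma fps_eqmodXn n k f g :
  fps_eqmod n f g -> fps_eqmod (k + n) (fpsX ^+ k * f) (fpsX ^+ k * g).
Proof.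
move=> fg d dn; rewrite !fpscoefM; apply: eq_bigr => i _; rewrite fpscoefXn.
case: eqP => [ik|_]; last by rewrite !mul0r.
by rewrite fg // ltn_subLR; [rewrite ik | rewrite -ltnS].
Qed.

Lemma fps_eqmod_mulX n k f g : (n <= k)%N -> fps_eqmod n (f + fpsX ^+ k * g) f.
Proof.
by move=> nk d dn; rewrite fpscoefD fpscoef_XnM ?addr0 // (leq_trans dn).
Qed.

Lemma fps_eqmod_unitl n P f g : P \is a GRing.unit ->
  fps_eqmod n (P * f) (P * g) -> fps_eqmod n f g.
Proof.
move=> uP /(fps_eqmodM n P^-1 P^-1 _ _ (fps_eqmod_refl _ _)).
by rewrite !mulrA mulVr // !mul1r.
Qed.

Lemma fps_eqmod_eq f g : (forall n, fps_eqmod n f g) -> f = g.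
Proof. by move=> fg; apply/fpsP => n; apply: (fg n.+1). Qed.

Definition fps_euler (f : fps rat) : fps rat := fpsX * fps_deriv f.

Lemma fpscoef_euler f n : fpscoef (fps_euler f) n = n%:R * fpscoef f n.
Proof.
rewrite fpscoefM; case: n => [|n].
  by rewrite big_ord1 -[fpsX]expr1 fpscoefXn !mul0r.
rewrite !big_ord_recl big1 => [|i _]; last first.
  by rewrite -[fpsX]expr1 fpscoefXn mul0r.
rewrite -[fpsX]expr1 !fpscoefXn /= mul0r add0r addr0 mul1r fpscoef_deriv.
by rewrite mulr_natl subn1.
Qed.

Lemma fps_eulerM f g :
  fps_euler (f * g) = fps_euler f * g + f * fps_euler g.
Proof.
apply/fpsP => n; rewrite fpscoef_euler fpscoefD !fpscoefM -big_split /=.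
rewrite mulr_sumr; apply: eq_bigr => i _; rewrite !fpscoef_euler.
have -> : n%:R = i%:R + (n - i)%:R :> rat.
  by rewrite -natrD subnKC // -ltnS.
ring.
Qed.

Lemma fps_eqmod_euler n f g :
  fps_eqmod n f g -> fps_eqmod n (fps_euler f) (fps_euler g).
Proof. by move=> fg d dn; rewrite !fpscoef_euler fg. Qed.

Lemma fps_euler1 : fps_euler 1 = 0.
Proof.
apply/fpsP => n; rewrite fpscoef_euler fpscoef1 fpscoef0.
by case: n => [|n]; rewrite ?mul0r ?mulr0.
Qed.

Lemma unit_1subXn n : (0 < n)%N -> 1 - fpsX ^+ n \is a @GRing.unit (fps rat).
Proof.
by move=> n0; rewrite fps_unitE fpscoefB fpscoefXn eq_sym gtn_eqF // subr0.
Qed.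

(** Multiplying E by the unit P turns the heat equation for Theta into a
    relation that involves the Euler derivative of P.  For k = 0 this relation
    reads c * euler P = - b_0 P E_1, which eliminates that derivative from all
    the others.  Congruences are enough, as N is arbitrary; P and Theta may
    depend on N. *)
Lemma heat_recurrence (E : nat -> fps rat) (a b : nat -> rat) (c : rat) :
  E 0%N = 1 -> a 0%N = 0 ->
  (forall N, exists P Theta,
    [/\ P \is a GRing.unit,
        forall k, fps_eqmod N (P * E k) (Theta k) &
        forall k, c *: fps_euler (Theta k)
                  = a k *: Theta k - b k *: Theta k.+1]) ->
  forall k, b k *: E k.+1 =
    (b 0%N *: E 1%N + (a k)%:A) * E k - c *: fps_euler (E k).
Proof.
move=> E0 a0 HE k; apply: fps_eqmod_eq => N.
have [P [Th [uP PE heat]]] := HE N.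
have PEheat j : fps_eqmod N (c%:A * (fps_euler P * E j + P * fps_euler (E j)))
                          ((a j)%:A * (P * E j) - (b j)%:A * (P * E j.+1)).
  rewrite -fps_eulerM !mulr_algl.
  apply: fps_eqmod_trans (fps_eqmodZ _ _ _ _ (fps_eqmod_euler _ _ _ (PE j))) _.
  rewrite heat; apply: fps_eqmod_sym.
  by apply: fps_eqmodB; apply: fps_eqmodZ.
have := PEheat 0%N; rewrite E0 fps_euler1 a0 scale0r mul0r !mulr1 mulr0 addr0.
move=> /(fps_eqmodM N _ _ _ _ (fps_eqmod_refl N (E k))) logder.
have dif := fps_eqmodB _ _ _ _ _ (PEheat k) logder.
apply: (fps_eqmod_unitl _ P) => //; 
rewrite -(mulr_algl (b k)) -(mulr_algl (b 0%N)) -(mulr_algl c).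
set lhs := (X in fps_eqmod _ X _) in dif.
set rhs := (X in fps_eqmod _ _ X).
have /fps_eqmod_sym := fps_eqmodB _ _ _ _ _ (fps_eqmod_refl N (rhs + lhs)) dif.
by congr (fps_eqmod _ _ _); rewrite /rhs /lhs; ring.
Qed.

(** * Central factorials *)

(** For m > 0 this is the central factorial of degree m divided by m!, that
    is s \prod_(0 < j < m) (s + m / 2 - j) / m!; the outermost factors
    s - (m / 2 - 1) and s + (m / 2 - 1) are what degree m has more than degree
    m - 2, whence the recursion in steps of two. *)
Fixpoint cfact (m : nat) (s : rat) : rat :=
  match m with
  | 0 => 1
  | 1 => s
  | m'.+2 => cfact m' s * (s ^+ 2 - (m'%:R / 2) ^+ 2) / (m'.+1 * m'.+2)%:R
  end.

Lemma cfactSS m s : cfact m.+2 s =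
  cfact m s * (s ^+ 2 - (m%:R / 2) ^+ 2) / (m.+1 * m.+2)%:R.
Proof. by []. Qed.

(** The first identity is the lowering rule for the second central difference.
    The recursion of [cfact] multiplies by a quadratic in s, so its shift by 1
    and -1 brings in the first difference as well: the second identity is what
    makes the induction close. *)
Lemma cfact_shift m s :
  cfact m.+2 (s + 1) + cfact m.+2 (s - 1) = 2 * cfact m.+2 s + cfact m s
  /\ s * (cfact m.+2 (s + 1) - cfact m.+2 (s - 1))
     = (2 * s ^+ 2 + m%:R / 2) / m.+1%:R * cfact m s.
Proof.
elim/ltn_ind: m => -[_|[_|m IH]].
- by split; rewrite !cfactSS /=; field.
- by split; rewrite !cfactSS /=; field.
have [sumH difH] := IH m (ltnW (ltnSn _)).
have m1 : m.+1%:R != 0 :> rat by rewrite Num.Theory.pnatr_eq0.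
have m2 : m.+2%:R != 0 :> rat by rewrite Num.Theory.pnatr_eq0.
have HS : cfact m.+2 s * (m.+1 * m.+2)%:R = cfact m s * (s ^+ 2 - (m%:R / 2) ^+ 2).
  by rewrite cfactSS -mulrA mulVf ?mulr1 // natrM mulf_neq0.
rewrite 3!(cfactSS m.+2); move: (cfact m s) sumH difH HS => h.
move: (cfact m.+2 s) (cfact m.+2 (s + 1)) (cfact m.+2 (s - 1)) => H Hp Hm.
move=> sumH difH HS.
have {}HS : H = h * (s ^+ 2 - (m%:R / 2) ^+ 2) / (m.+1%:R * m.+2%:R).
  by rewrite -HS natrM mulfK // mulf_neq0.
pose A := s ^+ 2 + 1 - (m.+2%:R / 2) ^+ 2.
have -> : (s + 1) ^+ 2 - (m.+2%:R / 2) ^+ 2 = A + 2 * s by rewrite /A; ring.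
have -> : (s - 1) ^+ 2 - (m.+2%:R / 2) ^+ 2 = A - 2 * s by rewrite /A; ring.
split.
  transitivity ((A * (Hp + Hm) + 2 * (s * (Hp - Hm))) / (m.+3 * m.+4)%:R).
    by ring.
  rewrite sumH difH HS /A; field.
  by rewrite nat1r -!natrD !Num.Theory.pnatr_eq0.
transitivity ((A * (s * (Hp - Hm)) + 2 * s ^+ 2 * (Hp + Hm)) / (m.+3 * m.+4)%:R).
  by ring.
rewrite sumH difH HS /A; field.
by rewrite nat1r -!natrD !Num.Theory.pnatr_eq0.
Qed.

(** * The finite Jacobi triple product *)

(** The exponents of the theta series: with x = i - N, this is x (x - 1) / 2
    for r = 1 and x ^ 2 for r = 2. *)
Definition theta_exp (r N i : nat) : nat :=
  let x : int := i%:Z - N%:Z in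
  `|((r%:Z * x ^+ 2 - (2 - r)%N%:Z * x) %/ 2)%Z|%N.

Lemma theta_expE r N i : (0 < r < 3)%N ->
  (2 * theta_exp r N i)%:Z
  = r%:Z * (i%:Z - N%:Z) ^+ 2 - (2 - r)%N%:Z * (i%:Z - N%:Z).
Proof.
rewrite /theta_exp; move: (i%:Z - N%:Z) => x.
case: r => [|[|[|r]]] //= _; last by rewrite subnn !expr2; nia.
rewrite subn1 /= !mul1r expr2.
(* The parity of x makes the division by 2 exact. *)
have [y [->|->]] : exists y : int, x = 2 * y \/ x = 2 * y + 1.
- by exists (x %/ 2)%Z; lia.
- by nia.
- by nia.
Qed.

Definition qpoch (r n : nat) : fps rat :=
  \prod_(j < n) (1 - fpsX ^+ (r * j.+1)).

Lemma qpochS r n : qpoch r n.+1 = qpoch r n * (1 - fpsX ^+ (r * n.+1)).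
Proof. by rewrite /qpoch big_ord_recr. Qed.

Lemma qpoch_unit r n : (0 < r)%N -> qpoch r n \is a GRing.unit.
Proof.
move=> r0; elim: n => [|n IH]; first by rewrite /qpoch big_ord0 unitr1.
by rewrite qpochS unitrM IH unit_1subXn // muln_gt0 r0.
Qed.

Lemma qpoch_eqmod r m n : (m <= n)%N ->
  fps_eqmod (r * m.+1) (qpoch r n) (qpoch r m).
Proof.
move=> /subnK <-; elim: (n - m)%N => [|d IH]; first by [].
rewrite addSn qpochS; apply: fps_eqmod_trans IH.
rewrite mulrBr mulr1 [_ * fpsX ^+ _]mulrC -mulrN.
by apply: fps_eqmod_mulX; rewrite leq_mul2l ltnS leq_addl orbT.
Qed.

(** This says that the coefficient of degree i of W is, up to the sign and the
    power of q, the Gaussian binomial coefficient of M and i in the base q^r,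
    with denominators cleared. *)
Definition jacobi_coef (r M N : nat) (W : {poly fps rat}) : Prop :=
  (forall i, (M < i)%N -> W`_i = 0) /\
  forall i, (i <= M)%N -> W`_i * (qpoch r i * qpoch r (M - i)) =
    (-1) ^+ (i + N) * fpsX ^+ theta_exp r N i * qpoch r M.

(** The two terms of the q-Pascal rule, over the common denominator that
    belongs to M + 1. *)
Lemma jacobi_coef_low {r M N W i} : jacobi_coef r M N W -> (i <= M.+1)%N ->
  W`_i * (qpoch r i * qpoch r (M.+1 - i)) =
  (-1) ^+ (i + N) * fpsX ^+ theta_exp r N i * qpoch r M
  * (1 - fpsX ^+ (r * (M.+1 - i))).
Proof.
move=> [W0 WE]; rewrite leq_eqVlt => /orP[/eqP ->|iM].
  by rewrite subnn muln0 expr0 subrr mulr0 W0 ?mul0r.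
by rewrite -WE -1?ltnS // subSn // qpochS; ring.
Qed.

Lemma jacobi_coef_high {r M N W i} : jacobi_coef r M N W -> (i <= M.+1)%N ->
  ('X * W)`_i * (qpoch r i * qpoch r (M.+1 - i)) =
  - ((-1) ^+ (i + N) * fpsX ^+ theta_exp r N i.-1 * qpoch r M)
  * (1 - fpsX ^+ (r * i)).
Proof.
move=> [W0 WE]; rewrite coefXM; case: i => [|i] /=; rewrite ?ltnS => iM.
  by rewrite muln0 expr0 subrr mulr0 mul0r.
have := WE i iM; rewrite subSS qpochS => Wi.
transitivity (W`_i * (qpoch r i * qpoch r (M - i)) * (1 - fpsX ^+ (r * i.+1))).
  by ring.
by rewrite Wi addSn exprS; ring.
Qed.

(** Adding one linear factor at a time, each step is a q-Pascal rule.  The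
    choice of M as 2 N + 2 - r here, and one more in the next step, makes the
    power of q in the new factor the one that the rule asks for. *)
Lemma jacobi_coef_step1 {r N W} : (0 < r < 3)%N ->
  let M := (2 * N + (2 - r))%N in
  jacobi_coef r M N W ->
  jacobi_coef r M.+1 N ((1 - (fpsX ^+ (r * N).+1)%:P * 'X) * W).
Proof.
move=> r12 M JW; have [W0 _] := JW.
have coefV i : ((1 - (fpsX ^+ (r * N).+1)%:P * 'X) * W)`_i =
    W`_i - fpsX ^+ (r * N).+1 * ('X * W)`_i.
  by rewrite mulrBl mul1r coefB -mulrA coefCM.
split=> i iM; rewrite coefV.
  rewrite coefXM; case: i iM => // i iM.
  by rewrite /= !W0 ?mulr0 ?subr0 // ltnW.
have lowW := jacobi_coef_low JW iM; have highW := jacobi_coef_high JW iM.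
rewrite mulrBl -[fpsX ^+ _ * _ * _]mulrA lowW highW.
case: i iM {lowW highW} => [|i] iM.
  by rewrite muln0 expr0 subrr !(mulr0, mul0r) subr0 subn0 qpochS; ring.
have e1 : ((r * N).+1 + theta_exp r N i = theta_exp r N i.+1 + r * (M.+1 - i.+1))%N.
  have := theta_expE r N i r12; have := theta_expE r N i.+1 r12.
  rewrite !expr2 /M; have : (i <= M)%N by []. rewrite /M.
  by case: r r12 {JW W0 coefV M iM} => [|[|[|r]]] //= _; nia.
have e2 : (r * M.+1 = r * (M.+1 - i.+1) + r * i.+1)%N by nia.
rewrite [i.+1.-1]/= qpochS e2 [fpsX ^+ (_ + r * _)]exprD.
transitivity ((-1) ^+ (i.+1 + N) * qpoch r M
  * (fpsX ^+ theta_exp r N i.+1 * (1 - fpsX ^+ (r * (M.+1 - i.+1)))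
  + fpsX ^+ ((r * N).+1 + theta_exp r N i) * (1 - fpsX ^+ (r * i.+1)))).
  by rewrite [fpsX ^+ (_ + theta_exp _ _ _)]exprD; ring.
by rewrite e1 [fpsX ^+ (theta_exp _ _ _ + _)]exprD; ring.
Qed.

Lemma jacobi_coef_step2 {r N W} : (0 < r < 3)%N ->
  let M := (2 * N + (2 - r)).+1%N in
  jacobi_coef r M N W ->
  jacobi_coef r M.+1 N.+1 (('X - (fpsX ^+ (r * N).+1)%:P) * W).
Proof.
move=> r12 M JW; have [W0 _] := JW.
have coefV i : (('X - (fpsX ^+ (r * N).+1)%:P) * W)`_i =
    ('X * W)`_i - fpsX ^+ (r * N).+1 * W`_i.
  by rewrite mulrBl coefB coefCM.
split=> i iM; rewrite coefV.
  rewrite coefXM; case: i iM => // i iM.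
  by rewrite /= !W0 ?mulr0 ?subr0 // ltnW.
have lowW := jacobi_coef_low JW iM; have highW := jacobi_coef_high JW iM.
rewrite mulrBl -[fpsX ^+ _ * _ * _]mulrA lowW highW.
have texpS j : theta_exp r N.+1 j.+1 = theta_exp r N j.
  rewrite /theta_exp; have -> // : j.+1%:Z - N.+1%:Z = j%:Z - N%:Z by lia.
case: i iM {lowW highW} => [|i] iM.
  rewrite muln0 expr0 subrr !(mulr0, mul0r) sub0r subn0 qpochS !add0n.
  have -> : theta_exp r N.+1 0 = ((r * N).+1 + theta_exp r N 0)%N.
    have := theta_expE r N 0 r12; have := theta_expE r N.+1 0 r12.
    by case: r r12 {JW W0 coefV M iM texpS} => [|[|[|r]]] //= _; nia.
  by rewrite exprD exprS [(-1) ^+ _.+1]exprS; ring.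
have e1 : ((r * N).+1 + theta_exp r N i.+1 = theta_exp r N i + r * i.+1)%N.
  have := theta_expE r N i r12; have := theta_expE r N i.+1 r12.
  by case: r r12 {JW W0 coefV M iM texpS} => [|[|[|r]]] //= _; nia.
have e2 : (r * M.+1 = r * (M.+1 - i.+1) + r * i.+1)%N by nia.
rewrite texpS [i.+1.-1]/= qpochS e2 [fpsX ^+ (_ + r * _)]exprD addnS [(-1) ^+ _.+1]exprS.
transitivity (- (-1) ^+ (i.+1 + N) * qpoch r M
  * (fpsX ^+ theta_exp r N i * (1 - fpsX ^+ (r * i.+1))
  + fpsX ^+ ((r * N).+1 + theta_exp r N i.+1) * (1 - fpsX ^+ (r * (M.+1 - i.+1))))).
  by rewrite [fpsX ^+ (_ + theta_exp _ _ _)]exprD; ring.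
by rewrite e1 [fpsX ^+ (theta_exp _ _ _ + _)]exprD; ring.
Qed.

(** As (z - y) (1 - y z) = z ((1 - y)^2 + y t) for t = 2 - z - z^-1, this
    polynomial in z is z^(N + (2 - r) / 2) times a product of N factors
    (1 - y)^2 + y t and, for r = 1, of z^(-1/2) - z^(1/2). *)
Definition theta_poly (r N : nat) : {poly fps rat} :=
  (1 - 'X) ^+ (2 - r) *
  \prod_(j < N) (('X - (fpsX ^+ (r * j).+1)%:P) * (1 - (fpsX ^+ (r * j).+1)%:P * 'X)).

Lemma theta_polyS r N : theta_poly r N.+1 =
  ('X - (fpsX ^+ (r * N).+1)%:P) * ((1 - (fpsX ^+ (r * N).+1)%:P * 'X) * theta_poly r N).
Proof. by rewrite /theta_poly big_ord_recr /=; ring. Qed.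

Lemma theta_poly_coef r N : (0 < r < 3)%N ->
  jacobi_coef r (2 * N + (2 - r)) N (theta_poly r N).
Proof.
move=> r12; elim: N => [|N IH]; last first.
  rewrite theta_polyS (_ : 2 * N.+1 + (2 - r) = (2 * N + (2 - r)).+2)%N; last by lia.
  by apply: jacobi_coef_step2 => //; apply: jacobi_coef_step1.
rewrite /theta_poly big_ord0 mulr1.
case: r r12 => [|[|[|r]]] // _.
  split=> [i|].
    by rewrite subn1 expr1 coefB coef1 coefX; case: i => [|[|i]] //; rewrite subr0.
  case=> [|[|i]] //= _; rewrite subn1 expr1 coefB coef1 coefX /=.
    by rewrite (_ : theta_exp 1 0 0 = 0%N) // [qpoch 1 0]big_ord0; ring.
  by rewrite (_ : theta_exp 1 0 1 = 0%N) // [qpoch 1 0]big_ord0; ring.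
split=> [i|]; first by rewrite subnn expr0 coef1; case: i.
case=> // _; rewrite subnn expr0 coef1 [qpoch 2 0]big_ord0.
by rewrite (_ : theta_exp 2 0 0 = 0%N) // !(expr0, mulr1).
Qed.

(** * Coefficients in t = 2 - z - 1/z *)

(** The linear functional with value h s at z^(-s), applied to the centred
    Laurent polynomial z^(-M/2) W(z). *)
Definition sym_sum (h : rat -> rat) (M : nat) (W : {poly fps rat}) : fps rat :=
  \sum_(i < M.+1) h (M%:R / 2 - i%:R) *: W`_i.

Lemma sym_sumB h M U V : sym_sum h M (U - V) = sym_sum h M U - sym_sum h M V.
Proof.
by rewrite -sumrB; apply: eq_bigr => i _; rewrite coefB scalerBr.
Qed.

Lemma sym_sumCM h M c U : sym_sum h M (c%:P * U) = c * sym_sum h M U.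
Proof.
by rewrite mulr_sumr; apply: eq_bigr => i _; rewrite coefCM scalerAr.
Qed.

(** The hypothesis relating h and h1 says that the functional of h, applied to
    t U, gives that of h1 at U; and W is multiplied by z ((1 - y)^2 + y t),
    where z is absorbed by the new centring. *)
Lemma sym_sum_step (h h1 : rat -> rat) M (y : fps rat) (W : {poly fps rat}) :
  (forall i, (M < i)%N -> W`_i = 0) ->
  (forall s, h (s + 1) + h (s - 1) = 2 * h s - h1 s) ->
  sym_sum h M.+2 (('X - y%:P) * ((1 - y%:P * 'X) * W)) =
  (1 - y) ^+ 2 * sym_sum h M W + y * sym_sum h1 M W.
Proof.
move=> W0 hE.
have -> : ('X - y%:P) * ((1 - y%:P * 'X) * W) =
    (1 + y ^+ 2)%:P * ('X * W) - y%:P * W - y%:P * ('X * ('X * W)).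
  by rewrite polyCD polyC_exp; ring.
rewrite !sym_sumB !sym_sumCM.
have -> : sym_sum h M.+2 W = sym_sum (fun s => h (s + 1)) M W.
  rewrite /sym_sum 2!big_ord_recr /= !W0 // !scaler0 !addr0.
  by apply: eq_bigr => i _; congr (h _ *: _); rewrite -!natr1; field.
have -> : sym_sum h M.+2 ('X * W) = sym_sum h M W.
  rewrite /sym_sum big_ord_recl coefXM /= scaler0 add0r big_ord_recr /= coefXM /=.
  rewrite W0 // scaler0 addr0; apply: eq_bigr => i _.
  by rewrite coefXM /=; congr (h _ *: _); rewrite /bump -!natr1; field.
have -> : sym_sum h M.+2 ('X * ('X * W)) = sym_sum (fun s => h (s - 1)) M W.
  rewrite /sym_sum 2!big_ord_recl !coefXM /= !scaler0 !add0r; apply: eq_bigr => i _.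
  by rewrite !coefXM /=; congr (h _ *: _); rewrite /bump -!natr1; field.
have -> : sym_sum h1 M W = 2 * sym_sum h M W
    - sym_sum (fun s => h (s + 1)) M W - sym_sum (fun s => h (s - 1)) M W.
  rewrite [X in X - _ - _]mulr_sumr -!sumrB; apply: eq_bigr => i _.
  have -> (a : rat) (f : fps rat) : 2 * (a *: f) = (2 * a) *: f.
    by rewrite !mulr_natl !mulr2n scalerDl.
  rewrite -!scalerBl -addrA -opprD hE.
  by congr (_ *: _); rewrite opprB addrC subrK.
by ring.
Qed.

(** The functional with these values at z^(-s) sends
    g(t) (z^(-1/2) - z^(1/2))^(2 - r) to the coefficient of t^k in the
    polynomial g.  In Chebyshev's terms, they are half the coefficients, as
    polynomials in t, of z^s + z^(-s) for r = 2 and of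
    (z^(-s) - z^s) / (z^(-1/2) - z^(1/2)) for r = 1. *)
Definition cheb_coef (r k : nat) (s : rat) : rat :=
  (-1) ^+ k * cfact (2 * k + (2 - r)) s.

Lemma cheb_coefS r k s : cheb_coef r k.+1 (s + 1) + cheb_coef r k.+1 (s - 1)
  = 2 * cheb_coef r k.+1 s - cheb_coef r k s.
Proof.
rewrite /cheb_coef (_ : 2 * k.+1 + (2 - r) = (2 * k + (2 - r)).+2)%N; last by lia.
rewrite -mulrDr (cfact_shift _ _).1 exprS; ring.
Qed.

Lemma cheb_coef0 r s : (0 < r < 3)%N ->
  cheb_coef r 0 (s + 1) + cheb_coef r 0 (s - 1) = 2 * cheb_coef r 0 s.
Proof. by case: r => [|[|[|r]]] // _; rewrite /cheb_coef /=; ring. Qed.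

Lemma cfact_origin d k : (d < 2)%N ->
  cfact (2 * k.+1 + d) (d%:R / 2) = 0.
Proof.
move=> d2; elim: k => [|k IH].
  by rewrite muln1 cfactSS subrr mulr0 mul0r.
rewrite (_ : 2 * k.+2 + d = (2 * k.+1 + d).+2)%N; last by lia.
by rewrite cfactSS IH !mul0r.
Qed.

Lemma cfactN m s : cfact m (- s) = (-1) ^+ m * cfact m s.
Proof.
elim/ltn_ind: m => -[_|[_|m IH]]; rewrite ?mul1r ?expr1 ?mulN1r //.
rewrite 2!(cfactSS m) (IH m (ltnW _)) // sqrrN.
by rewrite 2![(-1) ^+ _.+1]exprS !mulN1r opprK !mulrA.
Qed.

Definition local_prod (r N : nat) : {poly fps rat} :=
  \prod_(j < N) (((1 - fpsX ^+ (r * j).+1) ^+ 2)%:P + (fpsX ^+ (r * j).+1)%:P * 'X).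

(** By induction on N: [sym_sum_step] reproduces the multiplication by
    (1 - y)^2 + y t on coefficients.  For N = 0 only the values of the central
    factorials at 0 or 1/2 enter, and they vanish for k > 0. *)
Lemma local_prod_theta r N k : (0 < r < 3)%N ->
  (local_prod r N)`_k =
  sym_sum (cheb_coef r k) (2 * N + (2 - r)) (theta_poly r N).
Proof.
move=> r12; elim: N k => [|N IH] k.
  rewrite /local_prod big_ord0 coef1 add0n /theta_poly big_ord0 mulr1 /sym_sum.
  case: r r12 => [|[|[|r]]] // _.
    rewrite subn1 expr1 big_ord_recl big_ord1 !coefB !coef1 !coefX /=.
    rewrite !subr0 sub0r scalerN -scalerBl /cheb_coef subn1.
    rewrite [1 / 2 - (bump 0 0)%:R](_ : _ = - (1 / 2)); last by rewrite /bump /=; field.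
    rewrite cfactN addn1 exprS exprM expr1n.
    case: k => [|k].
      by rewrite /= expr0 -[LHS]scale1r; congr (_ *: _); field.
    have := cfact_origin 1 k isT; rewrite mulr1n addn1 => ->.
    by rewrite !mulr0 subr0 scale0r.
  rewrite subnn big_ord1 expr0 coef1 /cheb_coef subnn subr0.
  by case: k => [|k]; rewrite ?cfact_origin // ?mulr0 ?scale0r // /= mulr1 scale1r.
have W0 := (theta_poly_coef r N r12).1.
rewrite theta_polyS (_ : 2 * N.+1 + (2 - r) = (2 * N + (2 - r)).+2)%N; last by lia.
rewrite /local_prod big_ord_recr /= -/(local_prod r N) mulrDr coefD.
rewrite [local_prod _ _ * _]mulrC coefCM mulrA coefMX [local_prod _ _ * _]mulrC coefCM.
rewrite IH; case: k => [|k].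
  rewrite (sym_sum_step _ (fun=> 0) _ _ _ W0); last by move=> s; rewrite cheb_coef0 ?subr0.
  by rewrite [sym_sum (fun=> 0) _ _]big1 ?mulr0 // => i _; rewrite scale0r.
by rewrite (sym_sum_step _ (cheb_coef r k) _ _ _ W0) ?IH //; exact: cheb_coefS.
Qed.

(** * The heat equation modulo powers of q *)

Definition theta_sum (r N k : nat) : fps rat :=
  \sum_(i < (2 * N + (2 - r)).+1)
    cheb_coef r k ((2 * N + (2 - r))%:R / 2 - i%:R)
      *: ((-1) ^+ (i + N) * fpsX ^+ theta_exp r N i).

(** The Gaussian binomial coefficients agree with their limit only up to a
    degree that drops for i far from the middle; the growth of the exponent of
    the theta series makes up for it. *)
Lemma theta_exp_min r N i : (0 < r < 3)%N -> (i <= 2 * N + (2 - r))%N ->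
  (N < theta_exp r N i + r * (minn i (2 * N + (2 - r) - i)).+1)%N.
Proof.
move=> r12 iM; have := theta_expE r N i r12; rewrite expr2.
case: (leqP i N) => iN.
  rewrite (minn_idPl _); last by lia.
  by case: r r12 iM => [|[|[|r]]] // _ _ /=; nia.
rewrite (minn_idPr _); last by lia.
by case: r r12 iM => [|[|[|r]]] // _ iM /=; nia.
Qed.

(** The left-hand side is a monomial times (N) (M) / ((i) (M - i)), where (n)
    is short for [qpoch r n].  All four have at least mu = min(i, M - i)
    factors, so they agree modulo q^(r (mu + 1)). *)
Lemma qpoch_theta_coef r N i : (0 < r < 3)%N -> (i <= 2 * N + (2 - r))%N ->
  fps_eqmod N.+1 (qpoch r N * (theta_poly r N)`_i)
                 ((-1) ^+ (i + N) * fpsX ^+ theta_exp r N i).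
Proof.
set M := (2 * N + (2 - r))%N => r12 iM; have r0 : (0 < r)%N by case/andP: r12.
have := (theta_poly_coef r N r12).2 i iM; set w := _`_i.
set t := theta_exp r N i => wE.
pose mu := minn i (M - i).
have muN : (mu <= N)%N by rewrite /mu /M; lia.
have deg := theta_exp_min r N i r12 iM; rewrite -/t -/mu in deg.
apply: (fps_eqmod_unitl _ (qpoch r i * qpoch r (M - i))).
  by rewrite unitrM !qpoch_unit.
rewrite [X in fps_eqmod _ X _](_ : _ =
  (-1) ^+ (i + N) * (fpsX ^+ t * (qpoch r N * qpoch r M))); last first.
  by rewrite mulrCA [_ * w]mulrC wE; ring.
rewrite [X in fps_eqmod _ _ X](_ : _ =
  (-1) ^+ (i + N) * (fpsX ^+ t * (qpoch r i * qpoch r (M - i)))); last by ring.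
apply: fps_eqmodM => //; apply: (fps_eqmod_le _ _ _ _ deg); apply: fps_eqmodXn.
apply: (fps_eqmod_trans _ _ (qpoch r mu * qpoch r mu)).
  by apply: fps_eqmodM; apply: qpoch_eqmod; rewrite // /mu; lia.
by apply: fps_eqmod_sym; apply: fps_eqmodM; apply: qpoch_eqmod; rewrite // /mu; lia.
Qed.

Lemma local_prod_eqmod r N k : (0 < r < 3)%N ->
  fps_eqmod N.+1 (qpoch r N * (local_prod r N)`_k) (theta_sum r N k).
Proof.
move=> r12; rewrite local_prod_theta // /sym_sum mulr_sumr.
apply: fps_eqmod_sum => i _; rewrite -scalerAr; apply: fps_eqmodZ.
by apply: qpoch_theta_coef => //; rewrite -ltnS.
Qed.

Lemma fps_euler_signXn n t :
  fps_euler ((-1) ^+ n * fpsX ^+ t) = t%:R *: ((-1) ^+ n * fpsX ^+ t).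
Proof.
apply/fpsP => d; rewrite fpscoef_euler fpscoefZ -signr_odd mulr_sign.
by case: odd; rewrite ?fpscoefN fpscoefXn; case: eqP => [->|_]; rewrite ?oppr0 ?mulr0.
Qed.

(** Up to the constant 3 - r, the exponent of the theta series is
    s ^ 2 - ((2 - r) / 2) ^ 2, while the recursion of [cfact] provides the
    factor s ^ 2 - (k + (2 - r) / 2) ^ 2; their difference is k (k + 2 - r). *)
Lemma cheb_coef_heat r N i k : (0 < r < 3)%N ->
  let s := (2 * N + (2 - r))%:R / 2 - i%:R in
  (3 - r)%:R * (theta_exp r N i)%:R * cheb_coef r k s =
  (k * (k + (2 - r)))%:R * cheb_coef r k s
  - ((2 * k + (2 - r)).+1 * (2 * k + (2 - r)).+2)%:R * cheb_coef r k.+1 s.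
Proof.
move=> r12 s.
rewrite /cheb_coef (_ : 2 * k.+1 + (2 - r) = (2 * k + (2 - r)).+2)%N; last by lia.
rewrite cfactSS exprS; set m := (2 * k + (2 - r))%N.
have m12 : (m.+1 * m.+2)%:R != 0 :> rat by rewrite Num.Theory.pnatr_eq0.
move: (cfact m s) => h.
have -> : (m.+1 * m.+2)%:R * (-1 * (-1) ^+ k * (h * (s ^+ 2 - (m%:R / 2) ^+ 2) / (m.+1 * m.+2)%:R))
  = - ((-1) ^+ k * h * (s ^+ 2 - (m%:R / 2) ^+ 2)).
  by rewrite mulrC -!mulrA mulVf // mulr1; ring.
have tE : 2 * (theta_exp r N i)%:R =
    r%:R * (i%:R - N%:R) ^+ 2 - (2 - r)%:R * (i%:R - N%:R) :> rat.
  have /(congr1 (fun z : int => z%:~R : rat)) := theta_expE r N i r12.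
  by rewrite rmorphB !rmorphM rmorphB /= -!pmulrn natrM -expr2.
have -> : (theta_exp r N i)%:R =
    (r%:R * (i%:R - N%:R) ^+ 2 - (2 - r)%:R * (i%:R - N%:R)) / 2 :> rat.
  by rewrite -tE mulrC mulKf.
rewrite /s /m; case: r r12 {m m12 s tE} => [|[|[|r]]] // _;
  by rewrite ?(subn1, subnn, subn2) /= !natrM !natrD ?natrM; field.
Qed.

Lemma theta_sum_heat r N k : (0 < r < 3)%N ->
  (3 - r)%:R *: fps_euler (theta_sum r N k) =
  (k * (k + (2 - r)))%:R *: theta_sum r N k
  - ((2 * k + (2 - r)).+1 * (2 * k + (2 - r)).+2)%:R *: theta_sum r N k.+1.
Proof.
move=> r12; rewrite /theta_sum !scaler_sumr -sumrB.
have eulerD : {morph fps_euler : f g / f + g}.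
  by move=> f g; apply/fpsP => d; rewrite fpscoefD !fpscoef_euler fpscoefD mulrDr.
have euler0 : fps_euler 0 = 0.
  by apply/fpsP => d; rewrite fpscoef_euler fpscoef0 mulr0.
rewrite (big_morph _ eulerD euler0) scaler_sumr; apply: eq_bigr => i _.
set F := (-1) ^+ _ * fpsX ^+ _; have eulerF : fps_euler F = (theta_exp r N i)%:R *: F.
  exact: fps_euler_signXn.
have eulerZ a : fps_euler (a *: F) = a *: fps_euler F.
  by apply/fpsP => d; rewrite fpscoefZ !fpscoef_euler fpscoefZ mulrCA.
rewrite eulerZ eulerF !scalerA -scalerBl; congr (_ *: _).
rewrite -cheb_coef_heat //; ring.
Qed.

(** * MacMahon's series as elementary symmetric functions *)

(** Splitting off the largest entry matches the recursion on N of the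
    coefficients of a product of N factors 1 + x_j t. *)
Fixpoint increasing_seqs (N k : nat) : seq (seq nat) :=
  match N, k with
  | _, 0 => [:: [::]]
  | 0, _.+1 => [::]
  | N'.+1, k'.+1 => increasing_seqs N' k'.+1
                    ++ [seq rcons s N'.+1 | s <- increasing_seqs N' k']
  end.

Lemma mem_increasing_seqs N k s :
  (s \in increasing_seqs N k) =
  [&& size s == k, path ltn 0 s & all (fun i => i <= N)%N s].
Proof.
elim: N k s => [|N IH] [|k] s /=; rewrite ?inE ?in_nil.
- by case: s.
- by case: s => [|[|i] s]; rewrite ?andbF.
- by case: s.
rewrite mem_cat IH; case/lastP: s => [|s i].
  by rewrite /=; apply/mapP => -[s _ /(congr1 size)]; rewrite size_rcons.
rewrite size_rcons eqSS !all_rcons.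
have -> : (rcons s i \in [seq rcons s0 N.+1 | s0 <- increasing_seqs N k])
    = (i == N.+1) && (s \in increasing_seqs N k).
  apply/mapP/andP => [[s' s'in /rcons_inj[-> ->]]|[/eqP-> sin]]; first by rewrite eqxx.
  by exists s.
have -> : path ltn 0 (rcons s i)
    = [&& (0 < i)%N, all (fun j => j < i)%N s & path ltn 0 s].
  rewrite !(path_sortedE ltn_trans) all_rcons !(sorted_pairwise ltn_trans).
  by rewrite pairwise_rcons -!andbA; bool_congr; rewrite andbCA.
rewrite IH; case: (size s == k); rewrite ?andbF //=.
have le_all a b : (a <= b)%N -> all (fun j => j < a)%N s -> all (fun j => j <= b)%N s.
  by move=> ab; apply: sub_all => j /ltnW ja; apply: leq_trans ja ab.
case: (ltngtP i N.+1) => iN; rewrite ?andbF ?orbF //=.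
- rewrite (_ : i <= N)%N //=; case si: (all _ s); rewrite ?andbF //=.
  by rewrite !(le_all i) // ltnW.
- by rewrite (_ : (i <= N)%N = false) ?andbF //; lia.
rewrite iN ltnn /= andbF /=; case si: (all _ s); rewrite ?andbF //=.
by rewrite (le_all N.+1) ?andbT.
Qed.

Lemma increasing_seqs_uniq N k : uniq (increasing_seqs N k).
Proof.
elim: N k => [|N IH] [|k] //=; rewrite cat_uniq IH map_inj_uniq ?IH ?andbT /=.
  apply/hasPn => _ /mapP[s _ ->]; rewrite mem_increasing_seqs all_rcons ltnn.
  by rewrite !andbF.
by move=> s s' /rcons_inj[].
Qed.

Lemma sum_increasing_seqs (x : nat -> fps rat) N k :
  \sum_(s <- increasing_seqs N k) \prod_(i <- s) x i =
  (\prod_(j < N) (1 + (x j.+1)%:P * 'X))`_k.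
Proof.
elim: N k => [|N IH] k.
  rewrite big_ord0 coef1; case: k => [|k] /=; last by rewrite big_nil.
  by rewrite big_seq1 big_nil.
rewrite big_ord_recr /= mulrDr mulr1 mulrA coefD coefMX.
case: k => [|k] /=; first by rewrite -IH addr0; case: (N).
rewrite big_cat /= -!IH; congr (_ + _).
rewrite big_map mulrC coefCM -IH mulr_sumr; apply: eq_bigr => s _.
by rewrite big_rcons /= mulrC.
Qed.

(** Tuples with an entry beyond N contribute only in degrees above N. *)
Lemma fps_sum_increasing k N (F : seq nat -> fps rat) :
  (forall (m : k.-tuple nat) d, increasing_tuples m -> (d < \sum_(i <- m) i)%N ->
     fpscoef (F m) d = 0) ->
  fps_eqmod N.+1 (fps_sum (@increasing_tuples k) (fun m => F m))
                 (\sum_(s <- increasing_seqs N k) F s).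
Proof.
move=> F0 d dN; rewrite fpscoef_fps_sum fpscoef_sum.
set r : seq (k.-tuple nat) := pmap insub (increasing_seqs N k).
have rP (m : k.-tuple nat) : (m \in r) = path ltn 0%N m && all (fun i => i <= N)%N m.
  by rewrite mem_pmap_sub mem_increasing_seqs size_tuple eqxx.
have r_uniq : uniq r.
  by apply: (@pmap_uniq _ _ _ val) (increasing_seqs_uniq _ _); apply: insubK.
rewrite (fsbigE r) // => [|m|m mP].
- transitivity (\sum_(m <- r) fpscoef (F m) d).
    rewrite big_seq_cond [RHS]big_seq; apply: eq_bigl => m.
    case mr: (m \in r) => //=; apply/mem_set.
    by move: mr; rewrite rP => /andP[].
  rewrite /r big_pmap !big_seq; apply: eq_bigr => s.
  rewrite mem_increasing_seqs => /andP[sk _].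
  by rewrite (insubT (fun s : seq nat => size s == k) sk).
- by rewrite /= rP => /andP[].
rewrite rP (_ : path _ _ _) //= => /allPn[i im]; rewrite -ltnNge => Ni.
apply: F0 => //; apply: leq_trans dN _; apply: leq_trans Ni _.
by rewrite (big_rem i im) leq_addr.
Qed.

(** For i > 0 the exponent is i when r = 1 and 2 i - 1 when r = 2. *)
Definition part_weight (r i : nat) : fps rat :=
  let y := fpsX ^+ (r * i.-1).+1 in y / (1 - y) ^+ 2.

Definition macmahon (r k : nat) : fps rat :=
  fps_sum (@increasing_tuples k) (fun m => \prod_(i <- m) part_weight r i).

Lemma prod_part_weight (s : seq nat) (e : nat -> nat) :
  all (fun i => 0 < e i)%N s ->
  \prod_(i <- s) (fpsX ^+ e i / (1 - fpsX ^+ e i) ^+ 2) =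
  fpsX ^+ (\sum_(i <- s) e i) / \prod_(i <- s) (1 - fpsX ^+ e i) ^+ 2 :> fps rat.
Proof.
elim: s => [|i s IH] /=; first by rewrite !big_nil expr0 divr1.
case/andP=> ei es; rewrite !big_cons IH // exprD [in RHS]invrM ?unitrX ?unit_1subXn //.
  by ring.
exact: macmahon_den_unit.
Qed.

Lemma macmahonAE k : macmahonA k = macmahon 1 k.
Proof.
apply/fpsP => d; rewrite !fpscoef_fps_sum; apply: eq_fsbigr => m /set_mem mP.
have m_gt0 := increasing_tuples_gt0 mP.
rewrite /macmahonA_term -(prod_part_weight _ id) //; congr (fpscoef _ d).
rewrite !big_seq; apply: eq_bigr => i im.
by rewrite /part_weight mul1n prednK //; apply: (allP m_gt0).
Qed.

Lemma macmahonCE k : macmahonC k = macmahon 2 k.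
Proof.
apply/fpsP => d; rewrite !fpscoef_fps_sum; apply: eq_fsbigr => m /set_mem mP.
have /allP m_gt0 := increasing_tuples_gt0 mP.
rewrite /macmahonC_term.
have -> : (2 * (\sum_(i <- m) i) - k = \sum_(i <- m) (2 * i - 1))%N.
  rewrite [RHS]big_seq sumnB => [|i /m_gt0]; last by lia.
  by rewrite -!big_seq -big_distrr /= sum1_size size_tuple.
rewrite -(prod_part_weight _ (fun i => 2 * i - 1)%N); last first.
  by apply/allP => i /m_gt0; lia.
congr (fpscoef _ d); rewrite !big_seq; apply: eq_bigr => i /m_gt0 i0.
by rewrite /part_weight (_ : 2 * i - 1 = (2 * i.-1).+1)%N //; lia.
Qed.

Lemma macmahon0 r : macmahon r 0 = 1.
Proof.
apply/fpsP => d; rewrite fpscoef_fps_sum increasing_tuples0 fsbig_set1.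
by rewrite big_nil.
Qed.

Lemma prod_part_weight_low r (s : seq nat) d : (0 < r)%N -> all (leq 1) s ->
  (d < \sum_(i <- s) i)%N -> fpscoef (\prod_(i <- s) part_weight r i) d = 0.
Proof.
move=> r0 /allP s0 ds; rewrite (prod_part_weight s (fun i => (r * i.-1).+1)).
  apply: fpscoef_XnM; apply: leq_trans ds _.
  by rewrite big_seq [leqRHS]big_seq; apply: leq_sum => i /s0; nia.
exact/allP.
Qed.

(** The product of the (1 - q^e)^2 clears the denominators of the N factors
    1 + t q^e / (1 - q^e)^2. *)
Lemma macmahon_local_prod r N k : (0 < r)%N ->
  fps_eqmod N.+1 (\prod_(j < N) (1 - fpsX ^+ (r * j).+1) ^+ 2 * macmahon r k)
                 (local_prod r N)`_k.
Proof.
move=> r0; set c := \prod_(j < N) _.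
have -> : local_prod r N =
    c%:P * \prod_(j < N) (1 + (part_weight r j.+1)%:P * 'X).
  rewrite rmorph_prod -big_split /=; apply: eq_bigr => j _.
  rewrite mulrDr mulr1 mulrA -polyCM; congr (_ + _%:P * _).
  by rewrite /part_weight /= mulrCA divrr ?mulr1 // unitrX // unit_1subXn.
rewrite coefCM.
apply: fps_eqmodM => //; rewrite -sum_increasing_seqs.
apply: (fps_sum_increasing k N (fun s => \prod_(i <- s) part_weight r i)) => m d mP.
by apply: prod_part_weight_low => //; apply: increasing_tuples_gt0.
Qed.

(** * The recurrences *)

Lemma macmahon_recurrence r k : (0 < r < 3)%N ->
  ((2 * k + (2 - r)).+1 * (2 * k + (2 - r)).+2)%:R *: macmahon r k.+1 =
  (((2 - r).+1 * (2 - r).+2)%:R *: macmahon r 1 + (k * (k + (2 - r)))%:R)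
    * macmahon r k - (3 - r)%:R *: fps_euler (macmahon r k).
Proof.
move=> r12; have r0 : (0 < r)%N by case/andP: r12.
have := heat_recurrence (macmahon r)
  (fun j => (j * (j + (2 - r)))%:R)
  (fun j => ((2 * j + (2 - r)).+1 * (2 * j + (2 - r)).+2)%:R) (3 - r)%:R.
rewrite macmahon0 mul0n => /(_ erefl erefl) -> => [|N].
  by rewrite muln0 add0n [_%:A]scaler_nat.
exists (qpoch r N * \prod_(j < N) (1 - fpsX ^+ (r * j).+1) ^+ 2), (theta_sum r N).
split=> [|j|j]; last exact: theta_sum_heat.
  rewrite unitrM qpoch_unit // rpred_prod // => j _.
  by rewrite unitrX // unit_1subXn.
rewrite -mulrA; apply: fps_eqmod_le (leqnSn N) _.
apply: fps_eqmod_trans (local_prod_eqmod r N j r12).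
by apply: fps_eqmodM => //; apply: macmahon_local_prod.
Qed.

Theorem corollary3 (k : nat) (k_ge1 : (1 <= k)%N) :
  macmahonA k =
    (((2 * k + 1) * (2 * k))%:R^-1 : rat) *:
      ((6 *: macmahonA 1 + (k * (k - 1))%:R) * macmahonA (k - 1)
       - 2 *: (fpsX * fps_deriv (macmahonA (k - 1))))
  /\
  macmahonC k =
    (((2 * k) * (2 * k - 1))%:R^-1 : rat) *:
      ((2 *: macmahonC 1 + ((k - 1) ^ 2)%:R) * macmahonC (k - 1)
       - fpsX * fps_deriv (macmahonC (k - 1))).
Proof.
case: k k_ge1 => // k _; rewrite !macmahonAE !macmahonCE subSS subn0.
split.
  have := macmahon_recurrence 1 k isT; rewrite /fps_euler.
  rewrite (_ : (2 * k + 1).+1 * (2 * k + 1).+2 = (2 * k.+1 + 1) * (2 * k.+1))%N; last by lia.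
  rewrite (_ : k * (k + (2 - 1)) = k.+1 * k)%N => [<-|]; last by lia.
  by rewrite scalerA mulVf ?scale1r // Num.Theory.pnatr_eq0; lia.
have := macmahon_recurrence 2 k isT; rewrite /fps_euler.
rewrite (_ : (2 * k + 0).+1 * (2 * k + 0).+2 = 2 * k.+1 * (2 * k.+1 - 1))%N; last by lia.
rewrite (_ : k * (k + (2 - 2)) = k ^ 2)%N ?scale1r => [<-|]; last by lia.
by rewrite scalerA mulVf ?scale1r // Num.Theory.pnatr_eq0; lia.
Qed.
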